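(* Let $K$ be a number field with ring of integers $R$, and suppose $R$ is not a unique factorization domain. Then there exists a polynomial $f\in R[x]$ of degree at least $2$ that is indecomposable over $R$ but decomposable over $K$.
   Context: For a ring $A$ and $f\in A[x]$ with $\deg f\ge 2$, $f$ is called decomposable over $A$ if $f(x)=g(h(x))$ for some $g,h\in A[x]$ of degree at least $2$, and indecomposable over $A$ otherwise. *)

(* Defs.v *)
From HB Require Import structures.
From mathcomp Require Import all_boot all_order all_algebra all_field.
Set Implicit Arguments. Unset Strict Implicit. Unset Printing Implicit Defensive.
Import Order.TTheory GRing.Theory Num.Theory.
Local Open Scope ring_scope.

(* A number field is modelled as K : fieldExtType rat (a field that is a
   finite-dimensional Q-algebra).  Subrings of K are given by predicates. *)

Definition ring_of_integers (K : fieldExtType rat) (x : K) : Prop :=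
  integralOver (fun z : int => z%:~R : K) x.

Section SubringNotions.
Variables (K : fieldType) (A : K -> Prop).

Definition unitIn (x : K) : Prop := A x /\ x != 0 /\ A x^-1.

Definition irredIn (x : K) : Prop :=
  [/\ A x, x != 0, ~ unitIn x &
      forall a b, A a -> A b -> x = a * b -> unitIn a \/ unitIn b].

Definition associatedIn (x y : K) : Prop := exists2 u, unitIn u & x = u * y.

(* A (an integral domain, being a subring of a field) is a UFD:
   every nonzero nonunit is a product of irreducibles, uniquely up to
   order and associates. *)
Definition isUFD : Prop :=
  (forall x, A x -> x != 0 -> ~ unitIn x ->
     exists s : seq K, (forall y, y \in s -> irredIn y) /\ x = \prod_(y <- s) y)
  /\
  (forall s t : seq K, (forall y, y \in s -> irredIn y) ->
     (forall y, y \in t -> irredIn y) ->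
     \prod_(y <- s) y = \prod_(y <- t) y ->
     exists t' : seq K, [/\ perm_eq t t', size s = size t' &
        forall i, (i < size s)%N -> associatedIn (nth 0 s i) (nth 0 t' i)]).

Definition polyIn (p : {poly K}) : Prop := forall i, A p`_i.

Definition decomposableIn (f : {poly K}) : Prop :=
  exists g h : {poly K}, [/\ polyIn g, polyIn h, (2 < size g)%N,
                            (2 < size h)%N & f = g \Po h].
End SubringNotions.

(* Main.v *)
Require Import Defs.
From Stdlib Require Import Classical.
From HB Require Import structures.
From mathcomp Require Import all_boot all_order all_algebra all_field.
From mathcomp Require Import ring zify.
Import GRing.Theory Num.Theory.
Import VectorInternalTheory.
Local Open Scope ring_scope.

(* In R every nonzero nonunit factors into irreducibles, by descent on the norm
   (the determinant of multiplication).  So if R is not a UFD, some irreducible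
   p divides a product xy but neither x nor y.  With w = xy/p,
     f = (y/p)^2 (pX^2 + xX)^2 + (pX^2 + xX) = (yX^2 + wX)^2 + pX^2 + xX
   lies in R[X].  A decomposition of f over R is quadratic in quadratic, with
   inner polynomial aX^2 + bX + c; comparing coefficients gives b = a(x/p) and
   p = d a for some d in R.  If a is a unit, p divides x; if d is a unit,
   (y/p)^2 is in R, hence so is y/p as R is integrally closed. *)

(** * Matrix representation of a finite extension and integral characteristic polynomials *)

Lemma vector_rV (F : fieldType) (L : fieldExtType F) :
  exists n (e : {linear L -> 'rV[F]_n.+1}) (e' : {linear 'rV[F]_n.+1 -> L}),
    cancel e e' /\ cancel e' e.
Proof.
have [[|n] [e [e' [eK e'K]]]] : exists n (e : {linear L -> 'rV[F]_n})
    (e' : {linear 'rV[F]_n -> L}), cancel e e' /\ cancel e' e.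
- exists (dim L), v2r, r2v.
  by split; [apply: v2rK | apply: r2vK].
- have := oner_eq0 L.
  by rewrite -[1]eK (thinmx0 (e 1)) -(thinmx0 (e 0)) eK eqxx.
by exists n, e, e'.
Qed.

(** Each [x] goes to the matrix of multiplication by [x] in the coordinates [e]; matrices act on row
    vectors from the right, so the order of products is kept. *)
Lemma regular_representation (F : fieldType) (L : fieldExtType F) :
  exists n (M : {rmorphism L -> 'M[F]_n.+1}), True.
Proof.
have [n [e [e' [eK e'K]]]] := vector_rV F L.
pose m x (u : 'rV[F]_n.+1) := e (e' u * x).
have m_lin x : linear (m x).
  by move=> a u v; rewrite /m linearP mulrDl -scalerAl linearP.
pose mL x := HB.pack_for {linear 'rV[F]_n.+1 -> 'rV[F]_n.+1} (m x)
  (GRing.isLinear.Build F 'rV[F]_n.+1 'rV[F]_n.+1 _ (m x) (m_lin x)).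
pose M x := lin1_mx (mL x).
have ME x u : u *m M x = e (e' u * x) by rewrite mul_rV_lin1.
have MB : zmod_morphism M.
  by move=> x y; apply/row_matrixP=> i; rewrite !rowE mulmxBr !ME mulrBr linearB.
have MM : monoid_morphism M.
  split=> [|x y]; apply/row_matrixP=> i; rewrite !rowE.
    by rewrite ME mulr1 e'K mulmx1.
  by rewrite mulmxA !ME eK mulrA.
exists n, (HB.pack_for {rmorphism L -> 'M[F]_n.+1} M
  (GRing.isZmodMorphism.Build _ _ M MB) (GRing.isMonoidMorphism.Build _ _ M MM)).
by [].
Qed.

Lemma horner_mx_int (L : fieldType) n (M : {rmorphism L -> 'M[rat]_n.+1})
    (x : L) (p : {poly int}) :
  horner_mx (M x) (map_poly intr p) = M (map_poly intr p).[x].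
Proof.
rewrite -horner_map /horner_mx /horner_morph -!map_poly_comp; congr (_.[_]).
by apply: eq_map_poly => z /=; rewrite !rmorph_int.
Qed.

(* The complex eigenvalues of the matrix are algebraic integers, hence so are
   the coefficients of its characteristic polynomial, which are rational. *)
Lemma char_poly_int n (A : 'M[rat]_n.+1) (p : {poly int}) :
  p \is monic -> horner_mx A (map_poly intr p) = 0 ->
  exists q : {poly int}, char_poly A = map_poly intr q.
Proof.
move=> p_monic pA0; pose toC : {rmorphism rat -> algC} := ratr.
have rootA a : root (map_poly toC (char_poly A)) a -> a \in Aint.
  rewrite map_char_poly -eigenvalue_root_char eigenvalue_root_min.
  rewrite mxminpoly_map => rt_a.
  (* The minimal polynomial of [A] divides [p], so every eigenvalue is a root of a monic integer
     polynomial. *)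
  have {rt_a} rt_a : root (map_poly toC (map_poly intr p)) a.
    move: rt_a; rewrite -!dvdp_XsubCl => /dvdp_trans; apply.
    by rewrite dvdp_map; apply: mxminpoly_min.
  apply: root_monic_Aint rt_a _ _; first by rewrite !monic_map.
  by apply/polyOverP=> i; rewrite !coef_map /= rmorph_int rpred_int.
have [r Dr] := closed_field_poly_normal (map_poly toC (char_poly A)).
rewrite lead_coef_map (monicP (char_poly_monic A)) rmorph1 scale1r in Dr.
have AintP : map_poly toC (char_poly A) \is a polyOver Aint.
  rewrite Dr big_seq rpred_prod // => z zr; rewrite polyOverXsubC rootA //.
  by rewrite Dr root_prod_XsubC.
have /Num.Theory.floorpP[q Dq] : char_poly A \is a polyOver Num.int.
  apply/polyOverP=> i; have /polyOverP/(_ i) := AintP; rewrite coef_map /=.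
  move=> /Cint_rat_Aint-/(_ (Crat_rat _))/intrP[m Dm].
  by apply/intrP; exists m; apply: (fmorph_inj toC); rewrite rmorph_int.
by exists q.
Qed.

(** * Closure properties of the ring of integers and the norm *)

Section IntegerRing.
Variable K : fieldExtType rat.
Notation intK := (@ring_of_integers K).
Implicit Types x y : K.

Lemma intK_int (m : int) : intK m%:~R.
Proof. exact: (integral_id (intmul 1 : int -> K)). Qed.

Lemma intK1 : intK 1. Proof. exact: (intK_int 1). Qed.

Lemma intKD x y : intK x -> intK y -> intK (x + y).
Proof. exact: (@integral_add _ _ (intmul 1 : int -> K)). Qed.

Lemma intKM x y : intK x -> intK y -> intK (x * y).
Proof. exact: (@integral_mul _ _ (intmul 1 : int -> K)). Qed.

(** [x] is a root of the monic polynomial ['X^2 - (x ^+ 2)%:P], whose coefficients are integral. *)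
Lemma intK_sqr x : intK (x ^+ 2) -> intK x.
Proof.
move=> ix2; pose q := 'X^2 - (x ^+ 2)%:P.
apply: (@integral_root_monic _ _ (intmul 1 : int -> K) _ q).
- exact: monicXnsubC.
- by rewrite /root !hornerE subrr.
apply/integral_poly=> i; rewrite coefB coefXn coefC.
apply: integral_sub; first exact: integral_nat.
by case: eqP => // _; apply: integral0.
Qed.

(** [N x] is the absolute value of the determinant of multiplication by [x]. On [intK] this
    determinant is an integer, being up to sign the constant coefficient of the characteristic
    polynomial, so [numq] loses nothing there. Cayley-Hamilton gives the inverse of an element of
    norm 1. *)
Lemma integer_norm_exists : exists N : K -> nat,
  [/\ forall x y, intK x -> intK y -> N (x * y) = (N x * N y)%N,
      forall x, intK x -> x != 0 -> (0 < N x)%N &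
      forall x, intK x -> N x = 1%N -> intK x^-1].
Proof.
have [n [M _]] := regular_representation rat K.
have charM x : intK x -> exists q : {poly int}, char_poly (M x) = map_poly intr q.
  case=> p p_monic px0; apply: char_poly_int p_monic _.
  by rewrite horner_mx_int (rootP px0) rmorph0.
have detM x : intK x -> exists m : int, \det (M x) = m%:~R.
  case/charM=> q Dq; exists ((-1) ^+ n.+1 * q`_0).
  by rewrite rmorphM rmorphXn rmorphN1 -coef_map -Dq char_poly_det signrMK.
exists (fun x => `|numq (\det (M x))|%N); split=> [x y ix iy | x ix nz_x | x ix].
- rewrite rmorphM det_mulmx; have [[a ->] [b ->]] := (detM x ix, detM y iy).
  by rewrite -rmorphM !numq_int abszM.
- rewrite absz_gt0 numq_eq0; apply/eqP=> det0.
  have /eqP : \det (M x * M x^-1) = 1 by rewrite -rmorphM divff // rmorph1 det1.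
  by rewrite det_mulmx det0 mul0r eq_sym oner_eq0.
have [q Dq] := charM x ix; have [m Dm] := detM x ix.
rewrite Dm numq_int => Nm.
have q0 : q`_0 = (-1) ^+ n.+1 * m.
  apply: (@intr_inj rat); rewrite -coef_map -Dq char_poly_det Dm.
  by rewrite rmorphM rmorphXn rmorphN1.
have qx0 : (map_poly intr q).[x] = 0.
  by apply: (fmorph_inj M); rewrite -horner_mx_int -Dq Cayley_Hamilton rmorph0.
(* q_0 = 1 or -1, so q(x) = 0 exhibits x as a divisor of 1 or -1. *)
pose y := - (map_poly intr (\poly_(i < size q) q`_i.+1)).[x] : K.
have xy : y * x = (q`_0)%:~R.
  have Dq' : q = (\poly_(i < size q) q`_i.+1) * 'X + (q`_0)%:P.
    apply/polyP=> -[|i]; rewrite coefD coefMX coefC /= ?add0r // addr0 coef_poly.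
    by case: ltnP => // /leqW; apply: nth_default.
  move: qx0; rewrite [in map_poly _ _]Dq' rmorphD rmorphM /= map_polyX map_polyC.
  by rewrite !hornerE addrC mulNr => /eqP; rewrite addr_eq0 => /eqP ->.
have iy : intK y.
  apply: (@integral_opp _ _ (intmul 1 : int -> K)).
  apply: (@integral_horner _ _ (intmul 1 : int -> K)) => //.
  by apply/integral_poly => i; rewrite coef_map; apply: intK_int.
have q0_sqr : q`_0 * q`_0 = 1.
  rewrite q0 mulrACA -expr2 sqrr_sign mul1r.
  by rewrite (intEsign m) Nm mulr1 -expr2 sqrr_sign.
suff -> : x^-1 = (q`_0)%:~R * y by apply: intKM => //; apply: intK_int.
have xyq : (q`_0)%:~R * y * x = 1 by rewrite -mulrA xy -rmorphM q0_sqr.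
have nz_x : x != 0.
  by apply: contra_eq_neq xyq => ->; rewrite mulr0 eq_sym oner_eq0.
by apply: (mulIf nz_x); rewrite mulVf.
Qed.

(** * Existence of factorizations into irreducibles *)

Lemma unitInM x y : unitIn intK x -> unitIn intK y -> unitIn intK (x * y).
Proof.
move=> [ix [nz_x ix1]] [iy [nz_y iy1]]; split; first exact: intKM.
by rewrite mulf_neq0 // invfM; split=> //; apply: intKM.
Qed.

(** Nonzero nonunits have norm at least 2, so in a product of two of them each factor has a strictly
    smaller norm than the product; induction on a bound for the norm applies. *)
Lemma factorization_exists x : intK x -> x != 0 -> ~ unitIn intK x ->
  exists s : seq K, (forall y, y \in s -> irredIn intK y) /\ x = \prod_(y <- s) y.
Proof.
have [N [NM N_gt0 N1]] := integer_norm_exists.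
have N_nonunit a : intK a -> a != 0 -> ~ unitIn intK a -> (1 < N a)%N.
  move=> ia nz_a nu_a; rewrite ltn_neqAle N_gt0 // andbT eq_sym.
  by apply/eqP=> Na1; apply: nu_a; split=> //; split=> //; apply: N1.
have [n] := ubnP (N x); elim: n x => // n IHn x leNn ix nz_x nu_x.
case: (classic (irredIn intK x)) => [irr_x | red_x].
  by exists [:: x]; rewrite big_seq1; split=> // y; rewrite inE => /eqP->.
have [a [b [ia ib Dx nu_a nu_b]]] : exists a b,
    [/\ intK a, intK b, x = a * b, ~ unitIn intK a & ~ unitIn intK b].
  apply: NNPP => no_ab; apply: red_x; split=> // a b ia ib Dx.
  by apply: NNPP => /not_or_and[nu_a nu_b]; apply: no_ab; exists a, b.
have /andP[nz_a nz_b] : (a != 0) && (b != 0) by rewrite -negb_or -mulf_eq0 -Dx.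
move: leNn; rewrite ltnS Dx NM // => leNn.
have [Na Nb] := (N_nonunit a ia nz_a nu_a, N_nonunit b ib nz_b nu_b).
have [|s [irr_s ->]] := IHn a _ ia nz_a nu_a.
  by apply: leq_trans leNn; rewrite ltn_Pmulr // ltnW.
have [|t [irr_t ->]] := IHn b _ ib nz_b nu_b.
  by apply: leq_trans leNn; rewrite ltn_Pmull // ltnW.
exists (s ++ t); rewrite big_cat; split=> // y; rewrite mem_cat.
by case/orP=> [/irr_s | /irr_t].
Qed.

Lemma intK_prod (s : seq K) :
  (forall y, y \in s -> irredIn intK y) -> intK (\prod_(y <- s) y).
Proof.
move=> irr_s; rewrite big_seq; apply: (big_ind intK); first exact: intK1.
  exact: intKM.
by move=> y /irr_s[].
Qed.

(** * Prime elements and uniqueness of factorization *)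

(** For nonzero [x], divisibility by [x] in the ring of integers is integrality of the quotient in
    [K]. *)
Definition primeIn x := forall a b,
  intK a -> intK b -> intK (a * b / x) -> intK (a / x) \/ intK (b / x).

(** The alternative [intK x^-1] comes from the empty product, where [x] divides 1. *)
Lemma prime_dvd_prod x (s : seq K) : primeIn x ->
  (forall y, y \in s -> irredIn intK y) -> intK (\prod_(y <- s) y / x) ->
  intK x^-1 \/ exists2 y, y \in s & intK (y / x).
Proof.
move=> pr_x; elim: s => [|y s IHs] irr_s; first by rewrite big_nil div1r; left.
have irr_s' z : z \in s -> irredIn intK z.
  by move=> zs; apply: irr_s; rewrite inE zs orbT.
have [iy _ _ _] := irr_s y (mem_head _ _).
rewrite big_cons => /(pr_x _ _ iy (intK_prod _ irr_s'))[yx | sx].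
  by right; exists y; rewrite ?mem_head.
have [|[z zs zx]] := IHs irr_s' sx; first by left.
by right; exists z => //; rewrite inE zs orbT.
Qed.

(** The unit [u] makes the induction go through: the head [x] of [s] is prime, hence divides some
    [y] in [t], and cancelling [x] leaves the unit [y / x], which is absorbed into [u]. *)
Lemma factorization_unique (s t : seq K) u :
  (forall x, irredIn intK x -> primeIn x) -> unitIn intK u ->
  (forall y, y \in s -> irredIn intK y) -> (forall y, y \in t -> irredIn intK y) ->
  \prod_(y <- s) y = u * \prod_(y <- t) y ->
  exists t' : seq K, [/\ perm_eq t t', size s = size t' &
    forall i, (i < size s)%N -> associatedIn intK (nth 0 s i) (nth 0 t' i)].
Proof.
move=> irr_prime; elim: s t u => [|x s IHs] t u uu irr_s irr_t.
  case: t irr_t => [|y t] irr_t; first by exists [::]; split.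
  rewrite big_nil big_cons => uyt1; have [iy nz_y nu_y _] := irr_t y (mem_head _ _).
  case: nu_y; split=> //; split=> //.
  have -> : y^-1 = u * \prod_(z <- t) z.
    by apply: (mulfI nz_y); rewrite mulrCA -uyt1 divff.
  apply: intKM; first by case: uu.
  by apply: intK_prod => z zt; apply: irr_t; rewrite inE zt orbT.
rewrite big_cons => Dxs; have irr_x := irr_s x (mem_head _ _).
have [ix nz_x nu_x _] := irr_x; have [iu [nz_u iu1]] := uu.
have irr_s' z : z \in s -> irredIn intK z.
  by move=> zs; apply: irr_s; rewrite inE zs orbT.
have dvd_x : intK (\prod_(y <- t) y / x).
  have -> : \prod_(y <- t) y / x = u^-1 * \prod_(y <- s) y.
    by apply: (mulfI nz_u); rewrite mulrA -Dxs mulrAC divff // mul1r mulVKf.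
  by apply: intKM => //; apply: intK_prod.
have [ix1 | [y yt iyx]] := prime_dvd_prod _ _ (irr_prime x irr_x) irr_t dvd_x.
  by case: nu_x.
(* As [y] is irreducible and [x] is not a unit, [y = x * (y / x)] makes [y / x] a unit. *)
have [iy nz_y _ /(_ x (y / x) ix iyx)] := irr_t y yt.
rewrite mulrCA divff // mulr1 => /(_ erefl)[/nu_x // | uyx].
have irr_t' z : z \in rem y t -> irredIn intK z by move/mem_rem/irr_t.
have [] := IHs (rem y t) (u * (y / x)) (unitInM _ _ uu uyx) irr_s' irr_t'.
  apply: (mulfI nz_x); rewrite Dxs (perm_big _ (perm_to_rem yt)) big_cons /=.
  by field.
move=> t' [perm_t' sz_t' assoc_t']; exists (y :: t').
split=> [||[|i] /= ltis]; [|by rewrite /= sz_t'| |exact: assoc_t'].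
  by rewrite (perm_trans (perm_to_rem yt)) ?perm_cons.
exists (x / y); last by rewrite divfK.
have [_ [nz_yx iyx1]] := uyx; rewrite -invf_div; split=> //.
by rewrite invr_eq0 invrK.
Qed.

(** Used through its contrapositive: failure of unique factorization yields an irreducible element
    that is not prime. *)
Lemma primes_isUFD : (forall x, irredIn intK x -> primeIn x) -> isUFD intK.
Proof.
move=> irr_prime; split=> [|s t irr_s irr_t Dst]; first exact: factorization_exists.
apply: (factorization_unique s t 1) => //; last by rewrite mul1r.
by split; [apply: intK1 | rewrite oner_eq0 invr1; split=> //; apply: intK1].
Qed.

End IntegerRing.

(** * Composition of quadratics and the required polynomial *)

Lemma poly_size3 (F : fieldType) (p : {poly F}) :
  size p = 3%N -> p = Poly [:: p`_0; p`_1; p`_2] /\ p`_2 != 0.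
Proof.
move=> sz_p; have := lead_coef_eq0 p; rewrite lead_coefE sz_p -size_poly_eq0 sz_p.
move=> ->; split=> //; apply/polyP=> i; rewrite coef_Poly.
by case: i => [|[|[|i]]] //=; rewrite nth_nil nth_default // sz_p.
Qed.

Lemma comp_quadratics (F : fieldType) (A B C a b c : F) :
  Poly [:: C; B; A] \Po Poly [:: c; b; a] =
    Poly [:: A * c ^+ 2 + B * c + C; 2 * A * c * b + B * b;
             A * (b ^+ 2 + 2 * a * c) + B * a; 2 * A * a * b; A * a ^+ 2].
Proof.
rewrite /= !cons_poly_def !(comp_polyD, comp_polyM, comp_polyX, comp_polyC).
rewrite !expr2 !(polyCD, polyCM) polyC0; ring.
Qed.

Theorem theorem3p1 (K : fieldExtType rat) :
  ~ isUFD (@ring_of_integers K) ->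
  exists f : {poly K},
    [/\ polyIn (@ring_of_integers K) f, (2 < size f)%N,
        ~ decomposableIn (@ring_of_integers K) f &
        decomposableIn (fun _ : K => True) f].
Proof.
move=> notUFD.
have [p [x [y [irr_p [ix iy] ixyp nxp nyp]]]] : exists p x y : K,
    [/\ irredIn (@ring_of_integers K) p, ring_of_integers x /\ ring_of_integers y,
        ring_of_integers (x * y / p), ~ ring_of_integers (x / p) &
        ~ ring_of_integers (y / p)].
  apply: NNPP => no_pxy; apply: notUFD; apply: primes_isUFD => p irr_p x y ix iy ixyp.
  by apply: NNPP => /not_or_and[nxp nyp]; apply: no_pxy; exists p, x, y.
have [ip nz_p _ irr_p'] := irr_p.
have nz_y : y != 0.
  by apply/eqP=> y0; apply: nyp; rewrite y0 mul0r; apply: (intK_int K 0).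
have nz_z2 : (y / p) ^+ 2 != 0 by rewrite expf_neq0 // mulf_neq0 ?invr_eq0.
pose w := x * y / p.
(* Expansion of [(y X^2 + w X)^2 + p X^2 + x X], coefficients listed from the constant term up. *)
pose f := Poly [:: 0; x; w ^+ 2 + p; 2 * y * w; y ^+ 2].
have size_f : size f = 5%N by rewrite (PolyK (c := 0)) //= expf_neq0.
have Df : f = Poly [:: 0; 1; (y / p) ^+ 2] \Po Poly [:: 0; x; p].
  by rewrite comp_quadratics /f /w; congr (Poly [:: _; _; _; _; _]); field.
exists f; rewrite size_f; split=> //; last first.
- exists (Poly [:: 0; 1; (y / p) ^+ 2]), (Poly [:: 0; x; p]).
  by rewrite !(PolyK (c := 0)).
- move=> [G [H [iG iH szG szH Df']]].
  have [szG3 szH3] : size G = 3%N /\ size H = 3%N.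
    (* Degrees multiply under composition, and 4 is a product of two factors at least 2 only as 2
       times 2. *)
    have := size_comp_poly G H; rewrite -Df' size_f /=.
    case: (size G) szG => [|[|[|m]]] //; case: (size H) szH => [|[|[|n]]] //= _ _.
    by case: m n => [|m] [|n] //; rewrite /= ?mulnS ?mulSn; lia.
  have [[DG nz_G2] [DH nz_H2]] := (poly_size3 _ _ szG3, poly_size3 _ _ szH3).
  move: Df'; rewrite DG DH comp_quadratics.
  move: (iG 0%N) (iG 1%N) (iG 2%N) (iH 0%N) (iH 1%N) (iH 2%N) nz_G2 nz_H2.
  move: G`_0 G`_1 G`_2 H`_0 H`_1 H`_2 => C B A c b a.
  move=> iC iB iA ic ib ia nz_A nz_a {DG DH iG iH szG szH} /polyP Ef.
  have := (Ef 2%N, Ef 3%N, Ef 4%N); rewrite !coef_Poly /= => -[[E2 E3] E4] {Ef}.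
  have two_nz : (2 : K) != 0.
    by rewrite -(rmorph_nat (in_alg K)) fmorph_eq0.
  (* From [y ^+ 2 = A * a ^+ 2] and [2 * y * w = 2 * A * a * b], both sides agree after
     multiplication by [2 * y]. *)
  have yb : y * b = a * w.
    by apply: (mulfI nz_y); apply: (mulfI two_nz); ring: E3 E4.
  have Db : b = a * (x / p).
    by apply: (mulfI nz_y); rewrite yb /w; field.
  have Ab : A * b ^+ 2 = w ^+ 2.
    by rewrite Db exprMn mulrA -E4 /w; field.
  (* The degree 2 coefficients agree; [w ^+ 2] cancels against [A * b ^+ 2]. *)
  have Dp : p = (2 * A * c + B) * a.
    by apply: (addrI (w ^+ 2)); rewrite E2 -Ab; ring.
  have iB' : ring_of_integers (2 * A * c + B).
    by do 3?[apply: intKD | apply: intKM] => //; apply: (intK_int K 2).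
  move: (2 * A * c + B) iB' Dp => d id Dp.
  case: (irr_p' _ _ id ia Dp) => [[_ [nz_d id1]] | [_ [_ ia1]]].
    (* With [d] a unit, [(y / p) ^+ 2 = A * a ^+ 2 / (d * a) ^+ 2 = A / d ^+ 2] is integral. *)
    apply/nyp/intK_sqr; rewrite exprMn E4 Dp invfM exprMn.
    have -> : A * a ^+ 2 * (d^-1 ^+ 2 * a^-1 ^+ 2) = A * (d^-1 * d^-1).
      by field; rewrite ?nz_a ?nz_d.
    by do 2!apply: intKM => //.
  apply: nxp; have -> : x / p = b * a^-1 by rewrite Db mulrAC divff // mul1r.
  exact: intKM.
have i2 : ring_of_integers (2 : K) := intK_int K 2.
case=> [|[|[|[|[|i]]]]]; rewrite coef_Poly /= ?nth_nil ?expr2.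
- exact: (intK_int K 0).
- by [].
- by apply: intKD => //; apply: intKM.
- by do 2![apply: intKM => //].
- exact: intKM.
- exact: (intK_int K 0).
Qed.
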